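(* For $0<\delta\le\frac1{10}$, let $\Omega_0=(-\delta,\delta)$ and $$\Omega_1=\bigl(-2-\delta,-2+\delta\bigr)\cup\bigl(2-\delta,2+\delta\bigr).$$ Then, with $\Omega_t=(1-t)\Omega_0+t\Omega_1$, $$T_\gamma(\Omega_t)>\max\bigl(T_\gamma(\Omega_0),T_\gamma(\Omega_1)\bigr)\qquad\text{for }0<t<\tfrac\delta2 .$$ In particular, for every $\alpha>0$ the function $t\mapsto T_\gamma(\Omega_t)^{\alpha}$ is not convex on $[0,1]$, and neither is $t\mapsto\log T_\gamma(\Omega_t)$; hence, for every $\alpha>0$, the statement that $t\mapsto T_\gamma((1-t)K_0+tK_1)^{\alpha}$ is convex on $[0,1]$ for all open, bounded, centrally symmetric $K_0,K_1\subset\mathbb{R}$ is false.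
   Context: $\gamma$ is the standard Gaussian measure on $\mathbb{R}$, $d\gamma=(2\pi)^{-1/2}e^{-x^2/2}\,dx$. For a bounded open set $\Omega\subset\mathbb{R}$, the torsion function $u_\Omega$ is the solution of $u''-xu'=-1$ in $\Omega$, $u=0$ on $\partial\Omega$, and $T_\gamma(\Omega)=\int_\Omega u_\Omega\,d\gamma$. The Minkowski combination is $(1-t)\Omega_0+t\Omega_1=\{(1-t)x_0+tx_1:\ x_0\in\Omega_0,\ x_1\in\Omega_1\}$. Centrally symmetric means $\Omega=-\Omega$. *)

(* Defs.v *)
From mathcomp Require Import all_boot all_order all_algebra.
From mathcomp Require Import all_classical all_reals all_analysis.

Set Implicit Arguments.
Unset Strict Implicit.
Unset Printing Implicit Defensive.

Import Order.TTheory GRing.Theory Num.Theory.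
Import numFieldNormedType.Exports.

Local Open Scope classical_set_scope.
Local Open Scope ring_scope.

(* Classical solutions of u'' - x u' = -1 in Omega, u = 0 on the boundary.
   For Omega open, the boundary is [closure Omega `\` Omega]. *)
Definition torsion_solution (R : realType) (Omega : set R) (u : R -> R) : Prop :=
  [/\ {within closure Omega, continuous u},
      (forall x, Omega x ->
         [/\ derivable u x 1, derivable (derive1 u) x 1
           & derive1n 2 u x - x * derive1 u x = -1])
    & (forall x, (closure Omega `\` Omega) x -> u x = 0)].

(* On a bounded open Omega the solution exists and is unique on closure Omega;
   [xget] selects one of its extensions to the line, and the arbitrary values
   outside closure Omega do not enter [torsion]. *)
Definition torsion_function (R : realType) (Omega : set R) : R -> R :=
  xget (fun=> 0) [set u | torsion_solution Omega u].

(* [normal_prob 0 1] takes the standard deviation as second parameter. *)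
Definition torsion (R : realType) (Omega : set R) : R :=
  Rintegral (normal_prob 0 1) Omega (torsion_function Omega).

Definition minkowski_comb (R : realType) (t : R) (A B : set R) : set R :=
  [set (1 - t) * a + t * b | a in A & b in B].

Definition centrally_symmetric (R : realType) (A : set R) : Prop :=
  [set - x | x in A] = A.

(* Main.v *)
Require Import Defs.
From mathcomp Require Import all_boot all_order all_algebra.
From mathcomp Require Import all_classical all_reals all_analysis.
From mathcomp Require Import measurable_realfun.
From mathcomp Require Import ring lra.

(** Two mechanisms make the inequality true.

    The combination of the two sets is a union of two intervals of half-width
    [delta] centred at [-2t] and [2t].  For [0 < t < delta / 2] these overlap and
    the union is the symmetric interval of half-width [delta + 2t], which
    strictly contains [Omega0]; torsion strictly increases under this inclusion
    ([torsion_lt_itv]).  At [t = 1], on the other hand, the mass has been moved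
    to where the Gaussian density is about [exp (-2)] times its value at the origin,
    so that two copies of the interval there weigh less than one copy at the origin
    ([torsion_two_itv_lt]).  Hence the torsion has a strict interior excess over
    both of its end values, which no convex function can have, even after
    composition with an increasing function such as a power or the logarithm.

    Everything quantitative comes from a minimum principle for the operator
    [w'' - x w'] ([minimum_principle]): since
    [(exp (- x^2/2) w')' = exp (- x^2/2) (w'' - x w')], a supersolution has a
    nonincreasing weighted derivative, hence no interior dip below its boundary
    values.  Comparing the torsion function of an interval with the parabolas
    [A (r^2 - (x - c)^2)] bounds it from both sides, and the integrals of these
    parabolas are explicit.  Writing [p] for the density at 0, this gives
      [T(Omega0) >= p (199/200) (2/3) delta^3]  (density at least
        [p exp (- 1/200) >= p (199/200)], [A = 1/2]),
      [T(Omega1) <= 2 p (5/14) (64/75) delta^3]  (density at most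
        [p exp (-9/5) <= p / (1 + 9/5)], [A = 16/25]),
    and [199/300 > 64/105].

    The torsion function is a chosen solution of the boundary value problem, so
    solutions must also be shown to exist, on one interval and on two intervals
    separated by a gap; this is done by integrating the equation twice. *)

Set Implicit Arguments.
Unset Strict Implicit.
Unset Printing Implicit Defensive.

Import Order.TTheory GRing.Theory Num.Theory.
Import numFieldNormedType.Exports.

Local Open Scope classical_set_scope.
Local Open Scope ring_scope.

(** * The minimum principle for w'' - x w' *)

Section minimum_principle.
Variable R : realType.
Implicit Types (a b x m : R) (w dw d2w : R -> R).

Lemma is_derive_expR_halfsqr x :
  is_derive x 1 (fun y : R => expR (y ^+ 2 / 2)) (x * expR (x ^+ 2 / 2)).
Proof.
by apply: is_derive_eq; rewrite /GRing.scale /=; field.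
Qed.

Lemma is_derive_expR_Nhalfsqr x :
  is_derive x 1 (fun y : R => expR (- (y ^+ 2 / 2)))
    (- x * expR (- (x ^+ 2 / 2))).
Proof.
by apply: is_derive_eq; rewrite /GRing.scale /=; field.
Qed.

(** A dip of [w] below [m] at [x] forces [dw < 0] somewhere on the left of [x] and
    [dw > 0] somewhere on the right, although [exp (- y^2/2) * dw y] is
    nonincreasing. *)
Lemma minimum_principle a b w dw d2w m : a < b ->
  {within `[a, b], continuous w} ->
  {in `]a, b[, forall x, is_derive x 1 w (dw x)} ->
  {in `]a, b[, forall x, is_derive x 1 dw (d2w x)} ->
  {in `]a, b[, forall x, d2w x - x * dw x <= 0} ->
  m <= w a -> m <= w b -> {in `[a, b], forall x, m <= w x}.
Proof.
move=> ab cw dw1 dw2 Lw ma mb x; rewrite in_itv/= => /andP[ax xb].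
rewrite leNgt; apply/negP => wxm.
have {}ax : a < x.
  by rewrite lt_neqAle ax andbT; apply: contraTneq wxm => <-; rewrite -leNgt.
have {}xb : x < b.
  by rewrite lt_neqAle xb andbT; apply: contraTneq wxm => ->; rewrite -leNgt.
have sub c d y : a <= c -> d <= b -> y \in `]c, d[ -> y \in `]a, b[.
  by move=> ac db; apply: subset_itv; rewrite bnd_simp.
have cws c d : a <= c -> d <= b -> {within `[c, d], continuous w}.
  by move=> ac db; apply: continuous_subspaceW cw; apply: subset_itv; rewrite bnd_simp.
have [y1 y1ax e1] := MVT ax (fun y h => dw1 y (sub _ _ _ (lexx a) (ltW xb) h))
  (cws _ _ (lexx a) (ltW xb)).
have [y2 y2xb e2] := MVT xb (fun y h => dw1 y (sub _ _ _ (ltW ax) (lexx b) h))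
  (cws _ _ (ltW ax) (lexx b)).
pose p y := expR (- (y ^+ 2 / 2)) * dw y.
have dp y : y \in `]a, b[ ->
    is_derive y 1 p (expR (- (y ^+ 2 / 2)) * (d2w y - y * dw y)).
  move=> yab; have d1 := dw2 y yab; have d2 := is_derive_expR_Nhalfsqr y.
  by by apply: is_derive_eq; rewrite /GRing.scale /=; field.
move: (y1ax) (y2xb); rewrite !in_itv/= => /andP[ay1 y1x] /andP[xy2 y2b].
have y12 : y1 < y2 by exact: lt_trans y1x xy2.
have inab y : y1 <= y -> y <= y2 -> y \in `]a, b[.
  by move=> ? ?; rewrite in_itv/= (lt_le_trans ay1)//= (le_lt_trans _ y2b).
have dp12 y : y \in `]y1, y2[ ->
    is_derive y 1 p (expR (- (y ^+ 2 / 2)) * (d2w y - y * dw y)).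
  by rewrite in_itv/= => /andP[? ?]; apply/dp/inab; exact: ltW.
have cp : {within `[y1, y2], continuous p}.
  apply: derivable_within_continuous => y; rewrite in_itv/= => /andP[y1y yy2].
  by have [] := dp y (inab _ y1y yy2).
have [y3 + e3] := MVT y12 dp12 cp.
rewrite in_itv/= => /andP[y13 y32].
have : p y2 - p y1 <= 0.
  rewrite e3 mulr_le0_ge0 ?subr_ge0 ?(ltW y12)// mulr_ge0_le0 ?expR_ge0//.
  by apply/Lw/inab; exact: ltW.
have dw1_lt0 : dw y1 < 0.
  have : dw y1 * (x - a) < 0 by rewrite -e1; lra.
  by rewrite pmulr_llt0// subr_gt0.
have dw2_gt0 : 0 < dw y2.
  have : 0 < dw y2 * (b - x) by rewrite -e2; lra.
  by rewrite pmulr_lgt0// subr_gt0.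
have : p y1 < 0 by rewrite /p pmulr_rlt0 ?expR_gt0.
have : 0 < p y2 by rewrite /p mulr_gt0 ?expR_gt0.
lra.
Qed.

End minimum_principle.

(** * Torsion solutions and their comparison with barriers *)

Section torsion_solutions.
Variable R : realType.
Implicit Types (a b c r x A : R) (u du q dq d2q : R -> R) (Omega : set R).

Lemma closure_itvoo a b : a < b -> closure `]a, b[%classic = `[a, b]%classic.
Proof.
move=> ab; have r0 : 0 < (b - a) / 2 by rewrite divr_gt0// subr_gt0.
have ea : (a + b) / 2 - (b - a) / 2 = a by field.
have eb : (a + b) / 2 + (b - a) / 2 = b by field.
have -> : `]a, b[%classic = ball ((a + b) / 2) ((b - a) / 2).
  by rewrite ball_itv ea eb.
by rewrite closure_ballE// closed_ball_itv// ea eb.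
Qed.

Lemma torsion_solution_derive Omega u x : torsion_solution Omega u -> Omega x ->
  is_derive x 1 u (derive1 u x) /\ is_derive x 1 (derive1 u) (x * derive1 u x - 1).
Proof.
move=> [_ + _] Ox => /(_ _ Ox)[d1 d2 e]; split.
  by apply: (DeriveDef d1); rewrite derive1E.
by apply: (DeriveDef d2); rewrite -derive1E; rewrite -e addrC subrK.
Qed.

Lemma torsion_solution_itv a b u : a < b -> torsion_solution `]a, b[%classic u ->
  [/\ {within `[a, b], continuous u}, u a = 0 & u b = 0].
Proof.
move=> ab [+ _ +]; rewrite closure_itvoo// => cu u0.
by split=> //; apply: u0; split; rewrite /= in_itv/= ?lexx ?ltxx ?(ltW ab) ?andbF.
Qed.

(** The definition speaks of [derive1 u] and its derivative; on an open set it is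
    enough to exhibit some function [du] in the role of the derivative. *)
Lemma torsion_solution_intro Omega u du : open Omega ->
  {within closure Omega, continuous u} ->
  (forall x, Omega x -> is_derive x 1 u (du x)) ->
  (forall x, Omega x -> is_derive x 1 du (x * du x - 1)) ->
  (forall x, (closure Omega `\` Omega) x -> u x = 0) ->
  torsion_solution Omega u.
Proof.
move=> oO cu d1 d2 u0; split => // x Ox.
have e : \forall y \near x, du y = derive1 u y.
  near=> y; have Oy : Omega y by near: y; exact: open_nbhs_nbhs.
  by have ? := d1 y Oy; rewrite derive1E derive_val.
have d3 := near_eq_is_derive e (d2 x Ox).
have ? := d1 x Ox.
split=> //; rewrite /derive1n/= !derive1E.
by rewrite !derive_val; ring.
Unshelve. all: by end_near. Qed.

(** The minimum principle applied to [q - u]. *)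
Lemma torsion_le_supersolution a b u q dq d2q : a < b ->
  torsion_solution `]a, b[%classic u ->
  {within `[a, b], continuous q} ->
  {in `]a, b[, forall x, is_derive x 1 q (dq x)} ->
  {in `]a, b[, forall x, is_derive x 1 dq (d2q x)} ->
  {in `]a, b[, forall x, d2q x - x * dq x <= -1} ->
  0 <= q a -> 0 <= q b -> {in `[a, b], forall x, u x <= q x}.
Proof.
move=> ab su cq dq1 dq2 Lq qa qb x xab.
have [cu ua ub] := torsion_solution_itv ab su.
rewrite -subr_ge0.
apply: (@minimum_principle R a b (q \- u) (dq \- derive1 u)
  (fun y => d2q y - (y * derive1 u y - 1)) 0 ab) => //=.
- by move=> y; apply: continuousB; [exact: cq|exact: cu].
- move=> y yab; have ? := dq1 y yab.
  by have [? _] := torsion_solution_derive su yab; exact: is_deriveB.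
- move=> y yab; have ? := dq2 y yab.
  by have [_ ?] := torsion_solution_derive su yab; exact: is_deriveB.
- by move=> y /Lq; lra.
- by rewrite ua subr0.
- by rewrite ub subr0.
Qed.

(** The minimum principle applied to [u - q]. *)
Lemma torsion_ge_subsolution a b u q dq d2q : a < b ->
  torsion_solution `]a, b[%classic u ->
  {within `[a, b], continuous q} ->
  {in `]a, b[, forall x, is_derive x 1 q (dq x)} ->
  {in `]a, b[, forall x, is_derive x 1 dq (d2q x)} ->
  {in `]a, b[, forall x, -1 <= d2q x - x * dq x} ->
  q a <= 0 -> q b <= 0 -> {in `[a, b], forall x, q x <= u x}.
Proof.
move=> ab su cq dq1 dq2 Lq qa qb x xab.
have [cu ua ub] := torsion_solution_itv ab su.
rewrite -subr_ge0.
apply: (@minimum_principle R a b (u \- q) (derive1 u \- dq)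
  (fun y => (y * derive1 u y - 1) - d2q y) 0 ab) => //=.
- by move=> y; apply: continuousB; [exact: cu|exact: cq].
- move=> y yab; have ? := dq1 y yab.
  by have [? _] := torsion_solution_derive su yab; exact: is_deriveB.
- move=> y yab; have ? := dq2 y yab.
  by have [_ ?] := torsion_solution_derive su yab; exact: is_deriveB.
- by move=> y /Lq; lra.
- by rewrite ua sub0r oppr_ge0.
- by rewrite ub sub0r oppr_ge0.
Qed.

Definition parabola A c r x := A * (r ^+ 2 - (x - c) ^+ 2).

Lemma is_derive_parabola A c r x :
  is_derive x 1 (parabola A c r) (- 2 * A * (x - c)).
Proof.
by apply: is_derive_eq; rewrite /GRing.scale /=; ring.
Qed.

Lemma is_derive_parabola2 A c x :
  is_derive x 1 (fun y : R => - 2 * A * (y - c)) (- 2 * A).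
Proof.
by apply: is_derive_eq; rewrite /GRing.scale /=; ring.
Qed.

Lemma continuous_parabola A c r : continuous (parabola A c r).
Proof.
move=> x; apply: differentiable_continuous; apply/derivable1_diffP.
by have [] := is_derive_parabola A c r x.
Qed.

(** The operator [q'' - x q'] sends [parabola A c r] to [- 2 A (1 - x (x - c))], and
    the parabola vanishes at both ends of the interval: the hypothesis on [A] makes
    it a supersolution. *)
Lemma torsion_le_parabola A c r u : 0 < r ->
  torsion_solution `](c - r), (c + r)[%classic u ->
  {in `]c - r, c + r[, forall x, 1 <= 2 * A * (1 - x * (x - c))} ->
  {in `[c - r, c + r], forall x, u x <= parabola A c r x}.
Proof.
move=> r0 su H.
apply: (@torsion_le_supersolution _ _ _ (parabola A c r)
  (fun y => - 2 * A * (y - c)) (cst (- 2 * A))) => //.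
- lra.
- exact/continuous_subspaceT/continuous_parabola.
- by move=> x _; exact: is_derive_parabola.
- by move=> x _; exact: is_derive_parabola2.
- by move=> x /H /=; lra.
- by rewrite /parabola (_ : _ - _ = 0) ?mulr0//; ring.
- by rewrite /parabola (_ : _ - _ = 0) ?mulr0//; ring.
Qed.

Lemma torsion_ge_parabola A c r u : 0 < r ->
  torsion_solution `](c - r), (c + r)[%classic u ->
  {in `]c - r, c + r[, forall x, 2 * A * (1 - x * (x - c)) <= 1} ->
  {in `[c - r, c + r], forall x, parabola A c r x <= u x}.
Proof.
move=> r0 su H.
apply: (@torsion_ge_subsolution _ _ _ (parabola A c r)
  (fun y => - 2 * A * (y - c)) (cst (- 2 * A))) => //.
- lra.
- exact/continuous_subspaceT/continuous_parabola.
- by move=> x _; exact: is_derive_parabola.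
- by move=> x _; exact: is_derive_parabola2.
- by move=> x /H /=; lra.
- by rewrite /parabola (_ : _ - _ = 0) ?mulr0//; ring.
- by rewrite /parabola (_ : _ - _ = 0) ?mulr0//; ring.
Qed.

(** The equation is local and the end points of a component lie on the boundary of
    [Omega], so a solution on [Omega] solves the problem on each component.  The
    torsion of a union of intervals is thereby estimated one interval at a time. *)
Lemma torsion_solution_component Omega a b u : a < b ->
  `]a, b[%classic `<=` Omega -> ~ Omega a -> ~ Omega b ->
  torsion_solution Omega u -> torsion_solution `]a, b[%classic u.
Proof.
move=> ab sub na nb [cu du u0].
have csub := closureS sub.
split; first exact: continuous_subspaceW cu.
  by move=> x /sub/du.
move=> x [+ xab]; move=> cx; apply: u0; split; first exact: csub.
move: cx xab; rewrite closure_itvoo//= !in_itv/= => /andP[].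
rewrite le_eqVlt => /orP[/eqP <- //|ax].
by rewrite le_eqVlt => /orP[/eqP -> //|xb]; rewrite ax xb.
Qed.

Lemma torsion_functionP Omega : (exists u, torsion_solution Omega u) ->
  torsion_solution Omega (torsion_function Omega).
Proof. exact: xgetPex. Qed.

End torsion_solutions.

(** * Existence of torsion solutions *)

Section existence.
Variable R : realType.
Implicit Types (a b m x : R) (f u du : R -> R).

Lemma antiderivative a b f : {in `[a, b], forall x, {for x, continuous f}} ->
  exists F : R -> R, {in `]a, b[, forall x, is_derive x 1 F (f x)}.
Proof.
move=> cf; exists (fun x => \int[lebesgue_measure]_(t in `[a, x]) f t).
move=> x xab; move: (xab); rewrite in_itv/= => /andP[ax xb].
have fi : lebesgue_measure.-integrable `[a, b] (EFin \o f).
  apply: continuous_compact_integrable; first exact: segment_compact.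
  by apply: continuous_in_subspaceT => y /[!inE] yab; exact: cf.
have cx : {for x, continuous f} by apply: cf; rewrite in_itv/= !ltW.
have [d e] := continuous_FTC1_closed xb fi ax cx.
by apply: (DeriveDef d); rewrite -derive1E.
Qed.

(** The equation integrates to [u' = exp (x^2/2) (k - F)] with [F] an antiderivative
    of [exp (- x^2/2)], the constant [k] being fixed by the two boundary values.
    Derivatives are provided at the end points too, so that such solutions can be
    glued across a gap without a separate discussion of continuity. *)
Lemma torsion_exists_upto_boundary a b : a < b ->
  exists u du : R -> R, [/\ {in `[a, b], forall x, is_derive x 1 u (du x)},
    {in `[a, b], forall x, is_derive x 1 du (x * du x - 1)}, u a = 0 & u b = 0].
Proof.
move=> ab.
pose E x : R := expR (x ^+ 2 / 2).
pose G x : R := expR (- (x ^+ 2 / 2)).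
have dE x : is_derive x 1 E (x * E x) := is_derive_expR_halfsqr x.
have dG x : is_derive x 1 G (- x * G x) := is_derive_expR_Nhalfsqr x.
have cE x : {for x, continuous E}.
  by apply/differentiable_continuous/derivable1_diffP; case: (dE x).
have cG x : {for x, continuous G}.
  by apply/differentiable_continuous/derivable1_diffP; case: (dG x).
have EG x : E x * G x = 1 by rewrite -expRD subrr expR0.
(* [F] enters the integrand of [P], so its domain exceeds that of [P], which in
   turn exceeds the closed interval. *)
have [F dF] := antiderivative (a := a - 2) (b := b + 2) (fun x _ => cG x).
have [Q dQ] := antiderivative (a := a - 1) (b := b + 1) (fun x _ => cE x).
have [P dP] : exists P : R -> R,
    {in `]a - 1, b + 1[, forall x, is_derive x 1 P (E x * F x)}.
  apply: antiderivative => x; rewrite in_itv/= => /andP[ax xb].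
  apply: (@continuousM _ _ E F); first exact: cE.
  apply/differentiable_continuous/derivable1_diffP.
  by case: (dF x _); rewrite // in_itv/=; lra.
have in1 x : x \in `[a, b] -> x \in `]a - 1, b + 1[.
  by rewrite !in_itv/= => /andP[? ?]; lra.
have in2 x : x \in `[a, b] -> x \in `]a - 2, b + 2[.
  by rewrite !in_itv/= => /andP[? ?]; lra.
have [y yab Qab] : exists2 y, y \in `]a, b[ & Q b - Q a = E y * (b - a).
  apply: MVT ab _ _ => [y yab|].
    by apply: dQ; apply: in1; apply: subset_itv_oo_cc yab.
  by apply: derivable_within_continuous => y yab; case: (dQ y (in1 y yab)).
have Qab0 : Q b - Q a != 0 by rewrite Qab mulf_neq0 ?gt_eqF ?expR_gt0 ?subr_gt0.
pose k := (P b - P a) / (Q b - Q a).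
exists (fun x => k * (Q x - Q a) - (P x - P a)), (fun x => E x * (k - F x)).
split.
- move=> x xab; have ? := dQ x (in1 x xab); have ? := dP x (in1 x xab).
  by apply: is_derive_eq; rewrite /GRing.scale /=; ring.
- move=> x xab; have ? := dF x (in2 x xab); have ? := dE x.
  apply: is_derive_eq; rewrite /GRing.scale /=.
  by rewrite -[X in _ = _ - X](EG x); ring.
- by rewrite !subrr mulr0 subrr.
- by rewrite /k divfK// subrr.
Qed.

Lemma torsion_solution_itv_exists a b : a < b ->
  exists u : R -> R, torsion_solution `]a, b[%classic u.
Proof.
move=> ab; have [u [du [du1 du2 ua ub]]] := torsion_exists_upto_boundary ab.
have oc x : `]a, b[%classic x -> x \in `[a, b] by exact: subset_itv_oo_cc.
exists u; apply: (@torsion_solution_intro _ _ _ du).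
- exact: itv_open.
- rewrite closure_itvoo//; apply: derivable_within_continuous => x xab.
  by case: (du1 x xab).
- by move=> x /oc; exact: du1.
- by move=> x /oc; exact: du2.
- move=> x [+ xab]; move: xab; rewrite closure_itvoo//= !in_itv/= => + /andP[].
  rewrite le_eqVlt => + /orP[/eqP <- //|ax].
  by rewrite le_eqVlt => + /orP[/eqP -> //|xb]; rewrite ax xb.
Qed.

Lemma torsion_solution_setU_exists a b c d : a < b -> b < c -> c < d ->
  exists u : R -> R, torsion_solution (`]a, b[ `|` `]c, d[)%classic u.
Proof.
move=> ab bc cd.
have [u1 [du1 [d1u1 d2u1 u1a u1b]]] := torsion_exists_upto_boundary ab.
have [u2 [du2 [d1u2 d2u2 u2c u2d]]] := torsion_exists_upto_boundary cd.
pose m := (b + c) / 2.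
pose glue (f g : R -> R) x := if x < m then f x else g x.
have glueL f g x : x \in `[a, b] -> \forall y \near x, f y = glue f g y.
  rewrite in_itv/= => /andP[_ xb]; near=> y.
  suff ym : y < m by rewrite /glue ym.
  near: y; apply: lt_nbhsl; rewrite /m; lra.
have glueR f g x : x \in `[c, d] -> \forall y \near x, g y = glue f g y.
  rewrite in_itv/= => /andP[cx _]; near=> y.
  suff ym : m < y by rewrite /glue ltNge (ltW ym).
  near: y; apply: lt_nbhsr; rewrite /m; lra.
pose D : set R := (`[a, b] `|` `[c, d])%classic.
have DE : closure (`]a, b[ `|` `]c, d[)%classic = D.
  by rewrite closureU !closure_itvoo.
have OD : ((`]a, b[ `|` `]c, d[) `<=` D)%classic by rewrite -DE; exact: subset_closure.
have valL f g x : x \in `[a, b] -> glue f g x = f x.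
  by move=> xab; have /nbhs_singleton := glueL f g x xab.
have valR f g x : x \in `[c, d] -> glue f g x = g x.
  by move=> xab; have /nbhs_singleton := glueR f g x xab.
have dv1 x : D x -> is_derive x 1 (glue u1 u2) (glue du1 du2 x).
  move=> [xab|xcd].
    by rewrite valL//; apply: (near_eq_is_derive (glueL _ _ _ xab)); exact: d1u1.
  by rewrite valR//; apply: (near_eq_is_derive (glueR _ _ _ xcd)); exact: d1u2.
have dv2 x : D x -> is_derive x 1 (glue du1 du2) (x * glue du1 du2 x - 1).
  move=> [xab|xcd].
    by rewrite valL//; apply: (near_eq_is_derive (glueL _ _ _ xab)); exact: d2u1.
  by rewrite valR//; apply: (near_eq_is_derive (glueR _ _ _ xcd)); exact: d2u2.
have u0 x : (D `\` (`]a, b[ `|` `]c, d[))%classic x -> glue u1 u2 x = 0.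
  move=> [[xab|xcd] nx].
    rewrite valL//; move: xab; rewrite /= in_itv/= => /andP[].
    rewrite le_eqVlt => /orP[/eqP <- //|ax].
    rewrite le_eqVlt => /orP[/eqP -> //|xb].
    by case: nx; left; rewrite /= in_itv/= ax xb.
  rewrite valR//; move: xcd; rewrite /= in_itv/= => /andP[].
  rewrite le_eqVlt => /orP[/eqP <- //|cx].
  rewrite le_eqVlt => /orP[/eqP -> //|xd].
  by case: nx; right; rewrite /= in_itv/= cx xd.
move: dv1 dv2 u0; move: (glue u1 u2) (glue du1 du2) => u du dv1 dv2 u0.
have cu : {within closure (`]a, b[ `|` `]c, d[)%classic, continuous u}.
  rewrite DE; apply: continuous_in_subspaceT => x /[!inE] Dx.
  by apply/differentiable_continuous/derivable1_diffP; case: (dv1 x Dx).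
exists u.
have oU : open (`]a, b[ `|` `]c, d[)%classic.
  by apply: openU; exact: itv_open.
have t1 x : (`]a, b[ `|` `]c, d[)%classic x -> is_derive x 1 u (du x).
  by move=> /OD; exact: dv1.
have t2 x : (`]a, b[ `|` `]c, d[)%classic x -> is_derive x 1 du (x * du x - 1).
  by move=> /OD; exact: dv2.
rewrite -DE in u0.
exact (torsion_solution_intro oU cu t1 t2 u0).
Unshelve. all: by end_near. Qed.

End existence.

(** * Gaussian integrals of torsion solutions *)

Section gaussian_integrals.
Variable R : realType.
Implicit Types (a b c r x m M A mean dev : R) (f u q : R -> R).

Local Notation gauss := (@normal_prob R 0 1).
Local Notation leb := (@lebesgue_measure R).
Local Notation pdf := (@normal_pdf R 0 1).

(** The explicit density agrees almost everywhere with the Radon-Nikodym derivative,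
    as both integrate to the same measure; the change of variables for the latter
    then applies. *)
Lemma Rintegral_normal_prob mean dev (D : set R) f : measurable D ->
  (normal_prob mean dev).-integrable D (EFin \o f) ->
  \int[normal_prob mean dev]_(x in D) f x =
  \int[leb]_(x in D) (f x * normal_pdf mean dev x).
Proof.
move=> mD fi; rewrite /Rintegral; congr fine.
have dom : normal_prob mean dev `<< leb := @normal_prob_dominates R mean dev.
rewrite -(Radon_Nikodym_change_of_variables dom mD fi).
set RN := Radon_Nikodym _ _.
have mf := measurable_int _ fi.
have RNi : leb.-integrable D RN.
  by apply: (@integrableS _ _ _ leb setT D) => //; exact: Radon_Nikodym_integrable.
have mpdf : measurable_fun D (normal_pdf mean dev).
  by apply: (measurable_funS measurableT) => //; exact: measurable_normal_pdf.
apply: ae_eq_integral => //.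
- by apply: emeasurable_funM; [exact: mf|exact: measurable_int RNi].
- apply/measurable_EFinP; apply: measurable_funM; first exact/measurable_EFinP.
  exact: mpdf.
have RNE : ae_eq leb D RN (EFin \o normal_pdf mean dev).
  apply: integral_ae_eq => //; first exact/measurable_EFinP.
  by move=> E ED mE; rewrite /RN -Radon_Nikodym_integral.
by apply: filterS RNE => x /= /[apply] ->.
Qed.

Lemma continuous_within_integrable (mu : {measure set (measurableTypeR R) -> \bar R})
    (D K : set R) f : measurable D -> compact K -> D `<=` K -> (mu D < +oo)%E ->
  {within K, continuous f} -> mu.-integrable D (EFin \o f).
Proof.
move=> mD cK DK muD cf; apply: measurable_bounded_integrable => //.
  apply: (@measurable_funS _ _ _ _ K) => //; first exact: compact_measurable.
  by apply: subspace_continuous_measurable_fun => //; exact: compact_measurable.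
have /compact_bounded[M [_ mrt]] := continuous_compact cf cK.
exists M; split; rewrite ?num_real // => N MN x Dx; apply: (mrt N MN).
by exists x => //; exact: DK.
Qed.

Lemma gauss_integrable_compact (D K : set R) f :
  measurable D -> compact K -> D `<=` K ->
  {within K, continuous f} -> gauss.-integrable D (EFin \o f).
Proof.
move=> mD cK DK; apply: continuous_within_integrable => //.
by rewrite (le_lt_trans (probability_le1 _ _)) ?ltry.
Qed.

Lemma gauss_integrable_within a b f :
  {within `[a, b], continuous f} -> gauss.-integrable `]a, b[ (EFin \o f).
Proof.
apply: gauss_integrable_compact => //; first exact: segment_compact.
exact: subset_itv_oo_cc.
Qed.

Lemma leb_integrable_within a b f :
  {within `[a, b], continuous f} -> leb.-integrable `]a, b[ (EFin \o f).
Proof.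
apply: continuous_within_integrable => //; first exact: segment_compact.
  exact: subset_itv_oo_cc.
by rewrite /= lebesgue_measure_itv/=; case: ifPn; rewrite -?EFinB ltry.
Qed.

Lemma standard_normal_pdfE x : pdf x = normal_peak 1 * expR (- (x ^+ 2 / 2)).
Proof.
rewrite normal_pdfE ?oner_neq0//; congr (_ * expR _).
by rewrite subr0 expr1n mulNr.
Qed.

Lemma within_continuous_parabola A c r (D : set R) :
  {within D, continuous (parabola A c r)}.
Proof. exact/continuous_subspaceT/continuous_parabola. Qed.

Lemma parabola_ge0 A c r x : 0 <= A -> x \in `]c - r, c + r[ -> 0 <= parabola A c r x.
Proof.
move=> A0; rewrite in_itv/= => /andP[h1 h2]; apply: mulr_ge0 => //; nra.
Qed.

Lemma Rintegral_parabola A c r : 0 < r ->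
  \int[leb]_(x in `]c - r, c + r[) parabola A c r x = A * (4 / 3 * r ^+ 3).
Proof.
move=> r0; have cr : c - r < c + r by lra.
have ci : leb.-integrable `[c - r, c + r] (EFin \o parabola A c r).
  apply: continuous_compact_integrable; first exact: segment_compact.
  exact: within_continuous_parabola.
rewrite Rintegral_itv_obnd_cbnd ?Rintegral_itv_bndo_bndc//; last 2 first.
- by apply: integrableS ci => //; exact: subset_itv_co_cc.
- by apply: integrableS ci => //; exact: subset_itv_oo_cc.
pose F x := A * (r ^+ 2 * (x - c) - (x - c) ^+ 3 / 3).
have dF x : is_derive x 1 F (parabola A c r x).
  by apply: is_derive_eq; rewrite /GRing.scale /parabola /=; field.
have cF : continuous F.
  by move=> x; apply/differentiable_continuous/derivable1_diffP; case: (dF x).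
rewrite /Rintegral (@continuous_FTC2 _ _ F _ _ cr).
- by rewrite /= /F; field.
- exact: within_continuous_parabola.
- split; first by move=> x _; case: (dF x).
  + exact/cvg_at_right_filter/cF.
  + exact/cvg_at_left_filter/cF.
- by move=> x _; have ? := dF x; rewrite derive1E derive_val.
Qed.

(** The lower parabola is nonnegative, so its product with the lower bound [m] of the
    density stays below [u * pdf]; its Lebesgue integral is [A (4/3) r^3]. *)
Lemma torsion_mass_ge c r A m u : 0 < r -> 0 <= A ->
  torsion_solution `](c - r), (c + r)[%classic u ->
  {in `]c - r, c + r[, forall x, 2 * A * (1 - x * (x - c)) <= 1} ->
  {in `]c - r, c + r[, forall x, m <= pdf x} ->
  m * (A * (4 / 3 * r ^+ 3)) <= \int[gauss]_(x in `]c - r, c + r[) u x.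
Proof.
move=> r0 A0 su HA Hm; have cr : c - r < c + r by lra.
have [cu _ _] := torsion_solution_itv cr su.
have cpdf : continuous pdf by apply: continuous_normal_pdf; exact: oner_neq0.
have cpar := @within_continuous_parabola A c r `[c - r, c + r]%classic.
rewrite Rintegral_normal_prob//; last exact: gauss_integrable_within.
rewrite -(Rintegral_parabola A c r0) -RintegralZl//; last exact: leb_integrable_within.
apply: le_Rintegral => //.
- apply: leb_integrable_within => x; apply: continuousM; last exact: cpar.
  exact: cvg_cst.
- apply: leb_integrable_within => x; apply: continuousM; first exact: cu.
  exact: (continuous_subspaceT cpdf).
- move=> x xI; rewrite mulrC.
  have xcc : x \in `[c - r, c + r] by exact: subset_itv_oo_cc xI.
  apply: (@le_trans _ _ (parabola A c r x * pdf x)).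
    by rewrite ler_wpM2l ?parabola_ge0// Hm.
  by rewrite ler_wpM2r ?normal_pdf_ge0// (torsion_ge_parabola r0 su HA).
Qed.

Lemma torsion_mass_le c r A M u : 0 < r -> 0 <= A ->
  torsion_solution `](c - r), (c + r)[%classic u ->
  {in `]c - r, c + r[, forall x, 1 <= 2 * A * (1 - x * (x - c))} ->
  {in `]c - r, c + r[, forall x, pdf x <= M} ->
  \int[gauss]_(x in `]c - r, c + r[) u x <= M * (A * (4 / 3 * r ^+ 3)).
Proof.
move=> r0 A0 su HA HM; have cr : c - r < c + r by lra.
have [cu _ _] := torsion_solution_itv cr su.
have cpdf : continuous pdf by apply: continuous_normal_pdf; exact: oner_neq0.
have cpar := @within_continuous_parabola A c r `[c - r, c + r]%classic.
rewrite Rintegral_normal_prob//; last exact: gauss_integrable_within.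
rewrite -(Rintegral_parabola A c r0) -RintegralZl//; last exact: leb_integrable_within.
apply: le_Rintegral => //.
- apply: leb_integrable_within => x; apply: continuousM; first exact: cu.
  exact: (continuous_subspaceT cpdf).
- apply: leb_integrable_within => x; apply: continuousM; last exact: cpar.
  exact: cvg_cst.
- move=> x xI; rewrite [leRHS]mulrC.
  have xcc : x \in `[c - r, c + r] by exact: subset_itv_oo_cc xI.
  apply: (@le_trans _ _ (parabola A c r x * pdf x)).
    by rewrite ler_wpM2r ?normal_pdf_ge0// (torsion_le_parabola r0 su HA).
  by rewrite ler_wpM2l ?parabola_ge0// HM.
Qed.

Lemma ge0_subset_Rintegral d (T : measurableType d) (mu : {measure set T -> \bar R})
    (A B : set T) (f : T -> R) : measurable A -> measurable B -> A `<=` B ->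
  mu.-integrable B (EFin \o f) -> (forall t, B t -> 0 <= f t) ->
  \int[mu]_(x in A) f x <= \int[mu]_(x in B) f x.
Proof.
move=> mA mB AB fi f0; apply: fine_le.
- by apply: integrable_fin_num => //; exact: integrableS fi.
- exact: integrable_fin_num.
- by apply: ge0_subset_integral => //; exact: measurable_int fi.
Qed.

End gaussian_integrals.

(** * Minkowski combinations of the two sets *)

Section minkowski.
Variable R : realType.
Implicit Types (A B : set R) (d t x : R).

Lemma minkowski_comb0 A B : B !=set0 -> minkowski_comb 0 A B = A.
Proof.
move=> [b Bb]; apply/seteqP; split=> [_ [a Aa [b' Bb' <-]]|x Ax].
  by rewrite subr0 mul1r mul0r addr0.
by exists x => //; exists b => //; rewrite subr0 mul1r mul0r addr0.
Qed.

Lemma minkowski_comb1 A B : A !=set0 -> minkowski_comb 1 A B = B.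
Proof.
move=> [a Aa]; apply/seteqP; split=> [_ [a' Aa' [b Bb <-]]|x Bx].
  by rewrite subrr mul1r mul0r add0r.
by exists a => //; exists x => //; rewrite subrr mul1r mul0r add0r.
Qed.

(** The two intervals that make up the combination have half-width [d] and centres
    [2 t] and [- 2 t]; they overlap because [2 t < d].  A point is reached through
    the component of the second set that lies on its own side of the origin. *)
Lemma minkowski_comb_itv d t : 0 < t < d / 2 -> d < 2 ->
  minkowski_comb t `]- d, d[%classic
    (`](- 2 - d), (- 2 + d)[ `|` `](2 - d), (2 + d)[)%classic =
  `]- (d + 2 * t), (d + 2 * t)[%classic.
Proof.
move=> /andP[t0 td] d2; apply/seteqP; split=> [_ [a + [b + <-]]|x].
  by rewrite /= !in_itv/= => /andP[? ?] [] /andP[? ?]; nra.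
rewrite /= in_itv/= => /andP[xl xr]; have [x0|x0] := leP 0 x.
  exists (x - 2 * t); first by rewrite /= in_itv/=; lra.
  exists (2 + (x - 2 * t)); last by ring.
  by right; rewrite /= in_itv/=; lra.
exists (x + 2 * t); first by rewrite /= in_itv/=; lra.
exists (- 2 + (x + 2 * t)); last by ring.
by left; rewrite /= in_itv/=; lra.
Qed.

Lemma centrally_symmetricP A : (forall x, A x -> A (- x)) -> centrally_symmetric A.
Proof.
move=> AN; apply/seteqP; split=> [_ [x Ax <-]|x Ax]; first exact: AN.
by exists (- x); [exact: AN|rewrite opprK].
Qed.

Lemma bounded_set_normr_le (A : set R) (M : R) :
  (forall x, A x -> `|x| <= M) -> bounded_set A.
Proof.
move=> AM; exists M; split; first exact: num_real.
by move=> N MN x Ax; apply: le_trans (AM x Ax) (ltW MN).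
Qed.

End minkowski.

(** * A strict interior excess excludes convexity *)

Section convexity.
Variable R : realType.

Lemma convex_function_le_max (f : R -> R) t : 0 <= t <= 1 ->
  convex_function (`[0, 1]%classic : set R) f -> f t <= Num.max (f 0) (f 1).
Proof.
move=> /andP[t0 t1] cf.
have i0 : (0 : R) \in `[0, 1]%classic by rewrite inE/= in_itv/= lexx ler01.
have i1 : (1 : R) \in `[0, 1]%classic by rewrite inE/= in_itv/= lexx ler01.
have : f (t * 1 + (1 - t) * 0) <= t * f 1 + (1 - t) * f 0.
  exact: (cf (Itv01 t0 t1) 1 0 i1 i0).
rewrite mulr1 mulr0 addr0 => /le_trans; apply.
have f0 : f 0 <= Num.max (f 0) (f 1) by rewrite le_max lexx.
have f1 : f 1 <= Num.max (f 0) (f 1) by rewrite le_max lexx orbT.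
nra.
Qed.

Lemma increasing_comp_not_convex (g f : R -> R) t : 0 <= t <= 1 ->
  {in Num.pos &, {homo g : x y / x < y}} -> 0 < f 0 -> 0 < f 1 ->
  Num.max (f 0) (f 1) < f t ->
  ~ convex_function (`[0, 1]%classic : set R) (fun x => g (f x)).
Proof.
move=> t01 g_incr f0 f1; rewrite gt_max => /andP[lt0 lt1].
move=> /(convex_function_le_max t01); apply/negP; rewrite -ltNge gt_max.
have ft := lt_trans f0 lt0.
by rewrite !g_incr ?posrE.
Qed.

End convexity.

(** * Torsion of the symmetric interval and of the two far intervals *)

Section estimates.
Variable R : realType.
Implicit Types (r s d : R).

Local Notation gauss := (@normal_prob R 0 1).
Local Notation pdf := (@normal_pdf R 0 1).
Local Notation Omega0 d := (`]- d, d[%classic : set R).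
Local Notation Omega1 d :=
  ((`](- 2 - d), (- 2 + d)[ `|` `](2 - d), (2 + d)[)%classic : set R).

Lemma torsion_itv_solution (a b : R) : a < b ->
  torsion_solution `]a, b[%classic (torsion_function `]a, b[%classic).
Proof.
by move=> ab; apply: torsion_functionP; exact: torsion_solution_itv_exists.
Qed.

Lemma within_continuousZ (D : set R) k (f : R -> R) :
  {within D, continuous f} -> {within D, continuous (fun x => k * f x)}.
Proof. by move=> cf x; apply: continuousM; [exact: cvg_cst|exact: cf]. Qed.

Lemma pdf_ge (b x : R) : x ^+ 2 <= 2 * b -> normal_peak 1 * expR (- b) <= pdf x.
Proof.
move=> xb; rewrite standard_normal_pdfE ler_wpM2l ?normal_peak_ge0// ler_expR; lra.
Qed.

Lemma pdf_le (b x : R) : 2 * b <= x ^+ 2 -> pdf x <= normal_peak 1 * expR (- b).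
Proof.
move=> xb; rewrite standard_normal_pdfE ler_wpM2l ?normal_peak_ge0// ler_expR; lra.
Qed.

Lemma torsion_itv_gt0 r : 0 < r -> 0 < torsion (Omega0 r).
Proof.
move=> r0; have rr : - r < r by lra.
have sr := torsion_itv_solution rr.
rewrite /torsion; set u := torsion_function _ in sr *.
have := @torsion_mass_ge R 0 r (1 / 2)
  (normal_peak 1 * expR (- (r ^+ 2 / 2))) u r0.
rewrite sub0r add0r => /(_ _ sr)H; apply: lt_le_trans (H _ _ _); last 3 first.
- lra.
- by move=> x _; nra.
- by move=> x; rewrite in_itv/= => /andP[? ?]; apply: pdf_ge; nra.
by rewrite !mulr_gt0 ?expR_gt0 ?normal_peak_gt0 ?oner_neq0 ?exprn_gt0 ?invr_gt0.
Qed.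

(** On the smaller interval the torsion functions [u] of the smaller and [v] of the
    larger one satisfy [u <= v - K], where [K] bounds [v] from below at the end
    points of the smaller interval, by the lower parabola.  Since moreover
    [u <= r^2] by an upper parabola, the additive gap [K] is at least the
    multiplicative gap [K / r^2 * u], which integrates to a positive multiple of
    the torsion itself. *)
Lemma torsion_lt_itv r s : 0 < r <= 1 / 2 -> r < s ->
  torsion (Omega0 r) < torsion (Omega0 s).
Proof.
move=> /andP[r0 r2] rs; have := torsion_itv_gt0 r0; rewrite /torsion.
have rr : - r < r by lra.
have ss : - s < s by lra.
have sr := torsion_itv_solution rr.
have := torsion_itv_solution ss.
set u := torsion_function _ in sr *; set v := torsion_function _ => sv.
have [cu ua ub] := torsion_solution_itv rr sr.
have [cv va vb] := torsion_solution_itv ss sv.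
have s0 : 0 < s by lra.
have vge : {in `[- s, s], forall x, parabola (1 / 2) 0 s x <= v x}.
  have := @torsion_ge_parabola R (1 / 2) 0 s v s0.
  by rewrite sub0r add0r; apply=> // x _; nra.
have ule : {in `[- r, r], forall x, u x <= parabola 1 0 r x}.
  have := @torsion_le_parabola R 1 0 r u r0.
  by rewrite sub0r add0r; apply=> // x; rewrite in_itv/= => /andP[? ?]; nra.
pose K := (s ^+ 2 - r ^+ 2) / 2.
have sub : {subset `[- r, r] <= `[- s, s]}.
  by move=> x; rewrite !in_itv/= => /andP[? ?]; lra.
have cvr : {within `[- r, r], continuous v}.
  by apply: continuous_subspaceW cv; exact: sub.
have oo : {subset `]- r, r[ <= `]- s, s[}.
  by move=> x; rewrite !in_itv/= => /andP[? ?]; lra.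
have uK : {in `[- r, r], forall x, u x <= v x - K}.
  apply: (@torsion_le_supersolution R _ _ u _ (derive1 v)
    (fun x => x * derive1 v x - 1) rr) => //.
  - move=> x; apply: continuousB; last exact: cvg_cst.
    exact: cvr.
  - move=> x /oo xs; have [? _] := torsion_solution_derive sv xs.
    by apply: is_derive_eq; rewrite subr0.
  - by move=> x /oo xs; have [] := torsion_solution_derive sv xs.
  - by move=> x _; lra.
  - have := vge (- r) (sub _ _).
    rewrite /parabola /K in_itv/= lexx (ltW rr) => /(_ isT); lra.
  - have := vge r (sub _ _).
    rewrite /parabola /K in_itv/= lexx (ltW rr) => /(_ isT); lra.
move=> T0; pose c : R := 1 + K / r ^+ 2.
apply: (@lt_le_trans _ _ (c * \int[gauss]_(x in `]- r, r[) u x)).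
  rewrite ltr_pMl// /c ltrDl divr_gt0 ?exprn_gt0// /K; nra.
have iu := gauss_integrable_within cu; have iv := gauss_integrable_within cv.
have icu := gauss_integrable_within (within_continuousZ (k := c) cu).
have -> : c * \int[gauss]_(x in `]- r, r[) u x =
    \int[gauss]_(x in `]- r, r[) (c * u x).
  by rewrite RintegralZl.
apply: (@le_trans _ _ (\int[gauss]_(x in `]- r, r[) v x)).
  apply: le_Rintegral => //.
  - exact: integrableS iv.
  - move=> x xr; have xrc : x \in `[- r, r] by exact: subset_itv_oo_cc xr.
    have h1 := uK x xrc; have h2 := ule x xrc.
    have : K / r ^+ 2 * u x <= K; last by rewrite /c; lra.
    rewrite mulrAC ler_pdivrMr ?exprn_gt0//.
    apply: ler_wpM2l; first by rewrite /K; nra.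
    by move: h2; rewrite /parabola; nra.
apply: ge0_subset_Rintegral => // x xs.
have xsc : x \in `[- s, s] by exact: subset_itv_oo_cc xs.
apply: le_trans (vge x xsc); apply: parabola_ge0; first lra.
by rewrite sub0r add0r.
Qed.

(** The parabola with [A = 1/2] is a subsolution, and for [x^2 <= 1/100] the density
    is at least [p exp (- 1/200) >= p (199/200)], [p] being its value at 0. *)
Lemma torsion_center_ge d : 0 < d <= 1 / 10 ->
  normal_peak 1 * (199 / 200) * (2 / 3 * d ^+ 3) <= torsion (Omega0 d).
Proof.
move=> /andP[d0 d1]; rewrite /torsion.
have dd : - d < d by lra.
have sd := torsion_itv_solution dd.
set u := torsion_function _ in sd *.
have := @torsion_mass_ge R 0 d (1 / 2) (normal_peak 1 * (199 / 200)) u d0.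
rewrite sub0r add0r => /(_ _ sd)H.
rewrite (_ : 2 / 3 * d ^+ 3 = 1 / 2 * (4 / 3 * d ^+ 3)); last by field.
apply: H => [|x _|x]; [lra|nra|rewrite in_itv/= => /andP[xl xr]].
apply: le_trans (@pdf_ge (1 / 200) x _); last nra.
rewrite ler_wpM2l ?normal_peak_ge0//; apply: le_trans (expR_ge1Dx _); lra.
Qed.

Lemma torsion_two_itv d : 0 < d <= 1 / 10 ->
  let u := torsion_function (Omega1 d) in
  [/\ torsion_solution `](- 2 - d), (- 2 + d)[%classic u,
      torsion_solution `](2 - d), (2 + d)[%classic u &
      torsion (Omega1 d) = \int[gauss]_(x in `](- 2 - d), (- 2 + d)[) u x +
                           \int[gauss]_(x in `](2 - d), (2 + d)[) u x].
Proof.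
move=> /andP[d0 d1] u.
have l1 : - 2 - d < - 2 + d by lra.
have l2 : - 2 + d < 2 - d by lra.
have l3 : 2 - d < 2 + d by lra.
have su : torsion_solution (Omega1 d) u.
  exact/torsion_functionP/torsion_solution_setU_exists.
have s1 : torsion_solution `](- 2 - d), (- 2 + d)[%classic u.
  apply: (torsion_solution_component l1) su.
  - exact: subsetUl.
  - by move=> [] /=; rewrite in_itv/= => /andP[]; lra.
  - by move=> [] /=; rewrite in_itv/= => /andP[]; lra.
have s2 : torsion_solution `](2 - d), (2 + d)[%classic u.
  apply: (torsion_solution_component l3) su.
  - exact: subsetUr.
  - by move=> [] /=; rewrite in_itv/= => /andP[]; lra.
  - by move=> [] /=; rewrite in_itv/= => /andP[]; lra.
split=> //; rewrite /torsion Rintegral_setU//.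
- have [cu _ _] := su.
  apply: gauss_integrable_compact cu => //; first exact: measurableU.
    by rewrite closureU !closure_itvoo//; apply: compactU; exact: segment_compact.
  exact: subset_closure.
- apply/disj_setPS => x [] /=; rewrite !in_itv/= => /andP[? ?] /andP[? ?]; lra.
Qed.

(** Within distance [1/10] of [2] or [-2] one has [x (x - c) <= 21/100], so that
    [A = 16/25] gives a supersolution ([32/25 * 79/100 >= 1]); and [x^2 >= 361/100]
    bounds the density by [p exp (- 9/5) <= p / (1 + 9/5) = p (5/14)]. *)
Lemma torsion_two_itv_le d : 0 < d <= 1 / 10 ->
  torsion (Omega1 d) <= 2 * (normal_peak 1 * (5 / 14) * (64 / 75 * d ^+ 3)).
Proof.
move=> d01; have [s1 s2 ->] := torsion_two_itv d01; move/andP: d01 => [d0 d1].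
rewrite (_ : 64 / 75 * d ^+ 3 = 16 / 25 * (4 / 3 * d ^+ 3)); last by field.
have pdfM x : (19 / 10) ^+ 2 <= x ^+ 2 -> pdf x <= normal_peak 1 * (5 / 14).
  move=> xM; apply: le_trans (@pdf_le (9 / 5) x _) _; first nra.
  rewrite ler_wpM2l ?normal_peak_ge0// expRN -[leRHS]invf_div.
  rewrite lef_pV2 ?posrE ?expR_gt0//.
  by apply: le_trans (expR_ge1Dx _); lra.
rewrite mulr2n mulrDl mul1r; apply: lerD; apply: torsion_mass_le => //; try lra.
- by move=> x; rewrite in_itv/= => /andP[? ?]; nra.
- by move=> x; rewrite in_itv/= => /andP[? ?]; apply: pdfM; nra.
- by move=> x; rewrite in_itv/= => /andP[? ?]; nra.
- by move=> x; rewrite in_itv/= => /andP[? ?]; apply: pdfM; nra.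
Qed.

Lemma torsion_two_itv_gt0 d : 0 < d <= 1 / 10 -> 0 < torsion (Omega1 d).
Proof.
move=> d01; have [s1 s2 ->] := torsion_two_itv d01; move/andP: d01 => [d0 d1].
have d3 : 0 < d ^+ 3 by rewrite exprn_gt0.
have pdfm x : `|x| <= 3 -> normal_peak 1 * expR (- 5) <= pdf x.
  move=> xm; apply: pdf_ge; rewrite -real_normK ?num_real//.
  by have := normr_ge0 x; nra.
(* [A = 1/3] gives a subsolution: [2/3 * (1 + 21/100) <= 1]. *)
have mpos : 0 < normal_peak 1 * expR (- 5) * (1 / 3 * (4 / 3 * d ^+ 3)) :> R.
  by rewrite !mulr_gt0 ?expR_gt0 ?normal_peak_gt0 ?oner_neq0//; lra.
apply: addr_gt0; apply: (lt_le_trans mpos); apply: torsion_mass_ge => //; try lra.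
- by move=> x; rewrite in_itv/= => /andP[? ?]; nra.
- by move=> x; rewrite in_itv/= => /andP[? ?]; apply: pdfm; rewrite ler_norml; lra.
- by move=> x; rewrite in_itv/= => /andP[? ?]; nra.
- by move=> x; rewrite in_itv/= => /andP[? ?]; apply: pdfm; rewrite ler_norml; lra.
Qed.

Lemma torsion_two_itv_lt d : 0 < d <= 1 / 10 ->
  torsion (Omega1 d) < torsion (Omega0 d).
Proof.
move=> d01; apply: le_lt_trans (torsion_two_itv_le d01) _.
apply: lt_le_trans (torsion_center_ge d01).
have : 0 < normal_peak (1 : R) * d ^+ 3.
  case/andP: d01 => d0 _.
  by rewrite mulr_gt0 ?exprn_gt0 ?normal_peak_gt0 ?oner_neq0.
nra.
Qed.

(** * The torsion along the Minkowski path *)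

Lemma torsion_path_gt_max d t : 0 < d <= 1 / 10 -> 0 < t < d / 2 ->
  Num.max (torsion (Omega0 d)) (torsion (Omega1 d)) <
  torsion (minkowski_comb t (Omega0 d) (Omega1 d)).
Proof.
move=> d01 td; have /andP[d0 d1] := d01.
have lt0 : torsion (Omega0 d) < torsion (minkowski_comb t (Omega0 d) (Omega1 d)).
  by rewrite (minkowski_comb_itv td); [apply: torsion_lt_itv; lra|lra].
by rewrite gt_max lt0 (lt_trans (torsion_two_itv_lt d01) lt0).
Qed.

(** Stated for all increasing functions in order to treat the powers and the
    logarithm at once. *)
Lemma torsion_path_comp_not_convex d (g : R -> R) : 0 < d <= 1 / 10 ->
  {in Num.pos &, {homo g : x y / x < y}} ->
  ~ convex_function (`[0, 1]%classic : set R)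
      (fun t => g (torsion (minkowski_comb t (Omega0 d) (Omega1 d)))).
Proof.
move=> d01 g_incr; have /andP[d0 d1] := d01.
pose T t := torsion (minkowski_comb t (Omega0 d) (Omega1 d)).
have T0 : T 0 = torsion (Omega0 d).
  by rewrite /T minkowski_comb0//; exists 2; right; rewrite /= in_itv/=; lra.
have T1 : T 1 = torsion (Omega1 d).
  by rewrite /T minkowski_comb1//; exists 0; rewrite /= in_itv/=; lra.
apply: (@increasing_comp_not_convex _ g T (d / 4)) => //; first lra.
- by rewrite T0 torsion_itv_gt0.
- by rewrite T1 torsion_two_itv_gt0.
- by rewrite T0 T1; apply: torsion_path_gt_max => //; lra.
Qed.

Lemma torsion_path_powR_not_convex d alpha : 0 < d <= 1 / 10 -> 0 < alpha ->
  ~ convex_function (`[0, 1]%classic : set R)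
      (fun t => torsion (minkowski_comb t (Omega0 d) (Omega1 d)) `^ alpha).
Proof.
move=> d01 alpha0.
apply: (torsion_path_comp_not_convex (g := fun y => y `^ alpha) d01) => x y x0 y0.
by apply: gt0_ltr_powR => //; rewrite nnegrE ltW.
Qed.

End estimates.

Theorem proposition5p3 (R : realType) :
  (forall delta : R, 0 < delta <= 1 / 10 ->
     let Omega0 : set R := `]- delta, delta[%classic in
     let Omega1 : set R :=
       `](- 2 - delta), (- 2 + delta)[%classic `|`
       `](2 - delta), (2 + delta)[%classic in
     let T := fun t : R => torsion (minkowski_comb t Omega0 Omega1) in
     [/\ (forall t : R, 0 < t < delta / 2 ->
            Num.max (torsion Omega0) (torsion Omega1) < T t),
         (forall alpha : R, 0 < alpha ->
            ~ convex_function (`[0, 1]%classic : set R) (fun t => T t `^ alpha))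
       & ~ convex_function (`[0, 1]%classic : set R) (fun t => ln (T t))]) /\
  (forall alpha : R, 0 < alpha ->
     ~ (forall K0 K1 : set R,
          open K0 -> bounded_set K0 -> centrally_symmetric K0 ->
          open K1 -> bounded_set K1 -> centrally_symmetric K1 ->
          convex_function (`[0, 1]%classic : set R)
            (fun t => torsion (minkowski_comb t K0 K1) `^ alpha))).
Proof.
split=> [d d01 Omega0 Omega1 T|alpha alpha0 H].
  split.
  - by move=> t; exact: torsion_path_gt_max.
  - by move=> alpha; exact: torsion_path_powR_not_convex.
  - apply: torsion_path_comp_not_convex => // x y x0 y0 xy.
    by rewrite ltr_ln.
have d01 : 0 < (1 / 10 : R) <= 1 / 10 by lra.
apply: (torsion_path_powR_not_convex d01 alpha0); apply: H.
- exact: itv_open.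
- apply: (@bounded_set_normr_le _ _ 3) => x; rewrite /= in_itv/= => /andP[? ?].
  by rewrite ler_norml; lra.
- by apply: centrally_symmetricP => x; rewrite /= !in_itv/= => /andP[? ?]; lra.
- by apply: openU; exact: itv_open.
- apply: (@bounded_set_normr_le _ _ 3) => x [] /=; rewrite in_itv/= => /andP[? ?];
    rewrite ler_norml; lra.
- apply: centrally_symmetricP => x [] /=; rewrite !in_itv/= => /andP[? ?];
    [right|left]; lra.
Qed.
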